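(* Let $\mathcal{A}=((V_i)_{1\le i\le n},E)$ be an $n$-player arena (with a possibly infinite vertex set $V$), let $T_1,\dots,T_n\subseteq V$ and let $\mathcal{G}=(\mathcal{A},(\mathsf{B\ddot{u}chi}(T_i))_{1\le i\le n})$ be the associated Büchi game. Let $\sigma'$ be a Nash equilibrium from a vertex $v_0$ in $\mathcal{G}$ such that some vertex occurs infinitely often in $\mathsf{Out}(\sigma',v_0)$. Then there exists a finite-memory Nash equilibrium $\sigma$ from $v_0$ in $\mathcal{G}$ such that $\mathsf{SatPl}(\mathsf{Out}(\sigma,v_0))=\mathsf{SatPl}(\mathsf{Out}(\sigma',v_0))$. If $\mathcal{A}$ is finite, a memory size of at most $|V|+n^2+n$ suffices (i.e., $\sigma$ can be chosen such that each of its strategies has memory size at most $|V|+n^2+n$).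
   Context: Arenas. An $n$-player arena ($n\ge 1$) is $\mathcal{A}=((V_i)_{1\le i\le n},E)$ where $V$ is a (possibly infinite) set of vertices, $(V_i)_{1\le i\le n}$ is a partition of $V$ (parts may be empty; $V_i$ is the set of vertices controlled by player $P_i$), $E\subseteq V\times V$, and every vertex has at least one $E$-successor. A play is an infinite sequence $v_0v_1\ldots$ with $(v_\ell,v_{\ell+1})\in E$ for all $\ell\in\mathbb{N}$; a history is a finite non-empty prefix of a play. Strategies. A strategy of $P_i$ is a function $\sigma_i$ mapping each history $h$ ending in $V_i$ to an $E$-successor of the last vertex of $h$. A strategy profile is a tuple $\sigma=(\sigma_i)_{1\le i\le n}$ with one strategy per player. A play $v_0v_1\ldots$ is consistent with $\sigma_i$ if $v_\ell\in V_i$ implies $v_{\ell+1}=\sigma_i(v_0\ldots v_\ell)$ for all $\ell$. $\mathsf{Out}(\sigma,v_0)$ is the unique play from $v_0$ consistent with all strategies of $\sigma$. Finite memory. A Mealy machine of $P_i$ is $(M,m_{\mathsf{init}},\mathsf{up},\mathsf{nxt}_i)$ with $M$ a finite set, $m_{\mathsf{init}}\in M$, $\mathsf{up}\colon M\times V\to M$ and $\mathsf{nxt}_i\colon M\times V_i\to V$. Let $\widehat{\mathsf{up}}(\varepsilon)=m_{\mathsf{init}}$ and $\widehat{\mathsf{up}}(wv)=\mathsf{up}(\widehat{\mathsf{up}}(w),v)$ for $w\in V^*$, $v\in V$. The machine induces the strategy $\sigma_i(h'v)=\mathsf{nxt}_i(\widehat{\mathsf{up}}(h'),v)$ for every history $h'v$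 ending in $v\in V_i$ (with $h'\in V^*$ possibly empty). A strategy is finite-memory if it is induced by a Mealy machine, and has memory size at most $b$ if it is induced by some Mealy machine with $|M|\le b$. A strategy profile is finite-memory if all its strategies are. Objectives and equilibria. $\mathsf{B\ddot{u}chi}(T)$ is the set of plays $v_0v_1\ldots$ with $v_\ell\in T$ for infinitely many $\ell$; the objective of $P_i$ in $\mathcal{G}$ is $\mathsf{B\ddot{u}chi}(T_i)$. $\mathsf{SatPl}(\pi)=\{i\mid \pi\in\mathsf{B\ddot{u}chi}(T_i)\}$. A strategy profile $\sigma$ is a Nash equilibrium from $v_0$ if no player whose objective is not satisfied by $\mathsf{Out}(\sigma,v_0)$ has a strategy such that, when this player alone replaces their strategy in $\sigma$ by it, the outcome from $v_0$ satisfies their objective. *)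

(* Defs.v *)
From mathcomp Require Import all_boot.
From mathcomp Require Import boolp classical_sets functions cardinality.

Set Implicit Arguments.
Unset Strict Implicit.
Unset Printing Implicit Defensive.

Local Open Scope classical_set_scope.

(* The partition (V_i) of V into n possibly empty parts is encoded by the map
   [owner] sending a vertex to the index of its part: V_i = owner @^-1` [set i]. *)
Record arena (n : nat) (V : Type) := Arena {
  owner : V -> 'I_n;
  edge : V -> V -> Prop;
  edge_total : forall v, exists w, edge v w }.

Section Games.
Variables (n : nat) (V : Type) (A : arena n V).

Definition is_play (pi : nat -> V) : Prop := forall l, edge A (pi l) (pi l.+1).

Definition is_history (h : seq V) : Prop :=
  exists2 pi, is_play pi & exists l, h = mkseq pi l.+1.

(* [move s h v] is the image under s of the history [rcons h v]; it is
   meaningful only when [rcons h v] is a history and v belongs to player i, and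
   its other values are never used. *)
Record strategy (i : 'I_n) := Strategy {
  move :> seq V -> V -> V;
  moveP : forall h v,
    is_history (rcons h v) -> owner A v = i -> edge A v (move h v) }.

Definition profile := forall i : 'I_n, strategy i.

Definition consistent (i : 'I_n) (s : strategy i) (pi : nat -> V) : Prop :=
  forall l, owner A (pi l) = i -> pi l.+1 = s (mkseq pi l) (pi l).

(* The position (h, v) stands for the history [rcons h v]. *)
Definition next_pos (s : profile) (p : seq V * V) : seq V * V :=
  (rcons p.1 p.2, s (owner A p.2) p.1 p.2).

(* See [OutP] for the characterization as the unique consistent play. *)
Definition Out (s : profile) (v0 : V) (l : nat) : V :=
  (iter l (next_pos s) ([::], v0)).2.

Definition Buchi (T : set V) : set (nat -> V) :=
  [set pi | is_play pi /\ infinite_set [set l | T (pi l)]].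

Definition Buchi_game (T : 'I_n -> set V) (i : 'I_n) : set (nat -> V) :=
  Buchi (T i).

Definition SatPl (Obj : 'I_n -> set (nat -> V)) (pi : nat -> V) : set 'I_n :=
  [set i | Obj i pi].

(* [dfwith s t] is the profile s in which player i alone switches to t. *)
Definition Nash (Obj : 'I_n -> set (nat -> V)) (s : profile) (v0 : V) : Prop :=
  forall i : 'I_n, ~ SatPl Obj (Out s v0) i ->
    ~ exists t : strategy i, Obj i (Out (dfwith s t) v0).

(* Only the values of [nxt] at vertices of the machine's player are used. *)
Record mealy := Mealy {
  mem_state : finType;
  m_init : mem_state;
  up : mem_state -> V -> mem_state;
  nxt : mem_state -> V -> V }.

Definition up_hat (m : mealy) (w : seq V) : mem_state m :=
  foldl (@up m) (m_init m) w.

Definition induces (i : 'I_n) (m : mealy) (s : strategy i) : Prop :=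
  forall h v, is_history (rcons h v) -> owner A v = i ->
    s h v = nxt (up_hat m h) v.

Definition finite_memory (i : 'I_n) (s : strategy i) : Prop :=
  exists m : mealy, induces m s.

Definition memory_at_most (b : nat) (i : 'I_n) (s : strategy i) : Prop :=
  exists2 m : mealy, #|mem_state m| <= b & induces m s.

Definition finite_memory_profile (s : profile) : Prop :=
  forall i, finite_memory (s i).

Lemma next_posE (s : profile) v0 l :
  iter l (next_pos s) ([::], v0) = (mkseq (Out s v0) l, Out s v0 l).
Proof.
elim: l => [//|l IHl]; rewrite [LHS]surjective_pairing; congr pair.
by rewrite iterS IHl /= /mkseq -addn1 iotaD map_cat /= cats1.
Qed.

Lemma OutS (s : profile) v0 l :
  Out s v0 l.+1 = s (owner A (Out s v0 l)) (mkseq (Out s v0) l) (Out s v0 l).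
Proof. by rewrite {1}/Out iterS next_posE. Qed.

Lemma mkseqSr (pi : nat -> V) l : mkseq pi l.+1 = rcons (mkseq pi l) (pi l).
Proof. by rewrite /mkseq -addn1 iotaD map_cat /= cats1. Qed.

Lemma path_history (pi : nat -> V) l :
  (forall k, k < l -> edge A (pi k) (pi k.+1)) -> is_history (mkseq pi l.+1).
Proof.
move=> pathE; have [succ succP] := choice (edge_total A).
exists (fun k => if k <= l then pi k else iter (k - l) succ (pi l)).
  move=> k; case: (ltngtP k l) => [ltkl|ltlk|->].
  - exact: pathE.
  - by rewrite subSn ?(ltnW ltlk).
  - by rewrite subSnn.
exists l; apply: (@eq_from_nth _ (pi 0)); rewrite ?size_mkseq // => k ltkl.
by rewrite !nth_mkseq // -ltnS ltkl.
Qed.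

Lemma Out_play (s : profile) v0 : is_play (Out s v0).
Proof.
move=> l; elim/ltn_ind: l => l IHl; rewrite OutS; apply: moveP => //.
by rewrite -mkseqSr; apply: path_history.
Qed.

Lemma OutP (s : profile) v0 (pi : nat -> V) :
  pi = Out s v0 <->
  [/\ is_play pi, pi 0 = v0 & forall i, consistent (s i) pi].
Proof.
split=> [->|[_ pi0 cons]].
  by split=> [||i l <-]; [exact: Out_play | | exact: OutS].
apply/funext; elim/ltn_ind => -[_ //|l IHl].
rewrite (cons _ _ erefl) OutS IHl //; congr (s _ _ _).
by apply/eq_in_map => k; rewrite mem_iota /= => ltkl; apply: IHl; apply: leqW.
Qed.

End Games.

(* Main.v *)
Require Import Defs.
From mathcomp Require Import all_boot.
From mathcomp Require Import boolp classical_sets functions cardinality.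

Set Implicit Arguments.
Unset Strict Implicit.
Unset Printing Implicit Defensive.

Local Open Scope classical_set_scope.

(* A Büchi game is positionally determined for the coalition against a player i:
   a maximal positional strategy keeping T_i finitely visited exists by Zorn's
   lemma, and from every vertex outside its domain player i can force a visit to
   T_i followed by a return outside the domain, hence wins. So in a Nash
   equilibrium the outcome never leaves the domains of the players whose
   objective fails.
     The new equilibrium follows a lasso made of vertices of the old outcome and
   punishes, positionally, the first player who leaves it. The loop is cut into
   simple segments, so that a position in a segment is determined by the current
   vertex and the memory only has to know the segment and the owner of the
   previous vertex. A player who deviates without leaving the current segment is
   not noticed, which is harmless: the loop avoids the targets of the players
   whose objective fails. The handle may contain such targets, which is why its
   positions are tracked exactly. In a finite arena a simple handle (at most |V|
   positions) and n segments, one per target, suffice. *)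

Lemma infinite_set_natP (P : set nat) :
  infinite_set P <-> forall N, exists2 l, N <= l & P l.
Proof.
split=> [infP N|cofP /finite_seqP[s Ps]].
  apply: contrapT => noP; apply: infP; apply: (sub_finite_set _ (finite_II N)).
  by move=> l Pl /=; rewrite ltnNge; apply/negP => leNl; apply: noP; exists l.
have [l ltsl Pl] := cofP (\max_(x <- s) x).+1.
by move: Pl ltsl; rewrite Ps /= => sl; rewrite ltnNge leq_bigmax_seq.
Qed.

(** * Positional determinacy against one player *)

Section Determinacy.
Variables (n : nat) (V : Type) (A : arena n V) (i : 'I_n) (T : set V).

(* A positional strategy of the coalition against player i, given by the set S
   of the moves it permits: from a vertex in the domain of S, the play stays in
   the domain and sees T finitely often. *)
Record trap (S : set (V * V)) : Prop := Trap {
  trap_edge : forall v w, S (v, w) -> edge A v w;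
  trap_closed : forall v w, S (v, w) -> exists u, S (w, u);
  trap_free : forall v w u,
    owner A v = i -> S (v, w) -> edge A v u -> S (v, u);
  trap_det : forall v w u,
    owner A v <> i -> S (v, w) -> S (v, u) -> w = u;
  trap_fin : forall rho, (forall l, S (rho l, rho l.+1)) ->
    exists N, forall l, N <= l -> ~ T (rho l) }.

Definition controls (X : set V) (v : V) : Prop :=
  (owner A v = i /\ exists2 w, edge A v w & X w) \/
  (owner A v <> i /\ forall w, edge A v w -> X w).

(** The return to [X] comes right after the visit to [T], so that visits can be chained. The
    inductive definition stands for the transfinite attractor that infinite branching calls for. *)
Inductive attr (X : set V) : set V :=
| attr_visit v of T v & controls X v : attr X v
| attr_own v w of owner A v = i & edge A v w & attr X w : attr X v
| attr_opp v of owner A v <> i & (forall w, edge A v w -> attr X w) : attr X v.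

(** Chain condition for Zorn's lemma. A play permitted by the union never leaves the member [S] that
    permits its first move: on its domain [S] permits every edge at vertices of [i], and elsewhere a
    larger common member makes the move unique. *)
Lemma trap_bigcup (F : set (set (V * V))) :
  F `<=` trap -> total_on F subset -> trap (\bigcup_(S in F) S).
Proof.
move=> Ftrap Ftot.
have common S v w u u' : F S -> S (v, w) -> (\bigcup_(S in F) S) (v, u) ->
    (\bigcup_(S in F) S) (v, u') ->
  exists2 S', F S' & [/\ S' (v, w), S' (v, u) & S' (v, u')].
  move=> FS Sw [S1 FS1 S1u] [S2 FS2 S2u].
  have [S3 FS3 [SS3 S13]] : exists2 S3, F S3 & S `<=` S3 /\ S1 `<=` S3.
    by have [SS|SS] := Ftot _ _ FS FS1; [exists S1|exists S] => //; split => // x.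
  have [S23|S32] := Ftot _ _ FS2 FS3.
    by exists S3 => //; split; [apply: SS3|apply: S13|apply: S23].
  by exists S2 => //; split => //; apply: S32; [apply: SS3|apply: S13].
split.
- by move=> v w [S FS]; apply: trap_edge; apply: Ftrap.
- move=> v w [S FS /(trap_closed (Ftrap _ FS))[u Su]].
  by exists u; exists S.
- move=> v w u vi [S FS Svw] vu; exists S => //.
  exact: (trap_free (Ftrap _ FS)) Svw vu.
- move=> v w u vi [S FS Svw] [S' FS' Svu].
  have Uvw : (\bigcup_(S in F) S) (v, w) by exists S.
  have Uvu : (\bigcup_(S in F) S) (v, u) by exists S'.
  have [S3 FS3 [_ S3w S3u]] := common _ _ _ _ _ FS Svw Uvw Uvu.
  exact: (trap_det (Ftrap _ FS3)) vi S3w S3u.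
move=> rho Urho; have [S FS S0] := Urho 0.
apply: (trap_fin (Ftrap _ FS)); elim=> [//|l IHl].
have [u Su] := trap_closed (Ftrap _ FS) IHl.
have [S3 FS3 [S3u S3r _]] := common _ _ _ _ _ FS Su (Urho l.+1) (Urho l.+1).
case: (pselect (owner A (rho l.+1) = i)) => vi.
  apply: (trap_free (Ftrap _ FS)) Su _ => //.
  exact: (trap_edge (Ftrap _ FS3)) S3r.
by rewrite (trap_det (Ftrap _ FS3) vi S3r S3u).
Qed.

Lemma not_attr v (X : set V) : ~ attr X v ->
  exists w, [/\ edge A v w, T v -> ~ X w & ~ T v -> ~ attr X w].
Proof.
move=> nattr; case: (pselect (owner A v = i)) => vi.
  have [w vw] := edge_total A v; exists w; split => // [Tv Xw|_ aw].
    by apply: nattr; apply: attr_visit => //; left; split => //; exists w.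
  by apply: nattr; apply: attr_own vw aw.
apply: contrapT => now; apply: nattr; case: (pselect (T v)) => Tv.
  apply: attr_visit => //; right; split => // w vw.
  by apply: contrapT => nw; apply: now; exists w; split.
apply: attr_opp => // w vw.
by apply: contrapT => nw; apply: now; exists w; split.
Qed.

(* A trap whose complement is not covered by the attractor could be enlarged:
   outside of it the coalition avoids the attractor, and enters the trap as soon
   as T is visited. *)
Lemma maximal_trap : exists2 S : set (V * V), trap S &
  forall v, (forall w, ~ S (v, w)) -> attr [set u | forall w, ~ S (u, w)] v.
Proof.
have [S [trS maxS]] := Zorn_bigcup trap_bigcup; exists S => // v0 Xv0.
pose X := [set v | forall w, ~ S (v, w)]; apply: contrapT => nattr0.
pose Z v := X v /\ ~ attr X v.
have /choice[g gP] v : exists w, ~ attr X v ->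
    [/\ edge A v w, T v -> ~ X w & ~ T v -> ~ attr X w].
  have [av|/not_attr[w wP]] := pselect (attr X v); last by exists w.
  by have [w _] := edge_total A v; exists w.
pose S' := [set vw : V * V | S vw \/ [/\ Z vw.1, edge A vw.1 vw.2 &
                                     owner A vw.1 <> i -> vw.2 = g vw.1]].
have ZS v w : Z v -> ~ S (v, w) by case=> + _; apply.
have S'Z v w : Z v -> S' (v, w) ->
    [/\ edge A v w, T v -> ~ X w & ~ T v -> ~ attr X w].
  move=> Zv [/(ZS _ _ Zv)//|[_ /= vw vg]].
  have [Xv av] := Zv; case: (pselect (owner A v = i)) => vi; last first.
    by rewrite vg //; apply: gP.
  split=> // [Tv Xw|_ aw]; apply: av.
    by apply: attr_visit => //; left; split => //; exists w.
  exact: attr_own vw aw.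
have S'dom v : Z v -> exists u, S' (v, u).
  by move=> Zv; exists (g v); right; split => //=; case: (gP v Zv.2).
have SnX v : ~ X v -> exists w, S (v, w).
  by move=> nX; apply: contrapT => nS; apply: nX => w Sw; apply: nS; exists w.
have S'S v w u : S (v, w) -> S' (v, u) -> S (v, u).
  by move=> Svw [//|[/= Zv _ _]]; case: (ZS v w).
apply: (maxS S'); first split=> [|S'S0].
- by move=> vw; left.
- have Z0 : Z v0 by [].
  by have [u /S'S0] := S'dom _ Z0; apply: Xv0.
split.
- by move=> v w [/(trap_edge trS)//|[]].
- move=> v w [/(trap_closed trS)[u Su]|S'vw]; first by exists u; left.
  have [Zv _ _] := S'vw; have [_ vT vnT] := S'Z v w Zv (or_intror S'vw).
  have [Xw|/SnX[u Su]] := pselect (X w); last by exists u; left.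
  apply: S'dom; split => //; apply: vnT => Tv; exact: vT Xw.
- move=> v w u vi [Svw|[Zv _ _]] vu; first by left; apply: trap_free Svw vu.
  by right; split.
- move=> v w u vi Svw Svu; have [Xv|/SnX[x Sx]] := pselect (X v).
    case: Svw => [/Xv//|[/= Zv _ ->//]]; case: Svu => [/Xv//|[/= _ _ ->//]].
  exact: (trap_det trS vi (S'S _ _ _ Sx Svw) (S'S _ _ _ Sx Svu)).
(* A play of [S'] that leaves [X] follows [S] from then on; one that stays in [X] never meets [T],
   since a visit from [Z] exits [X] at the next move. *)
move=> rho rhoS'; have [[l0 nX]|allX] := pselect (exists l, ~ X (rho l)).
  have shiftS l : S (rho (l0 + l), rho (l0 + l).+1).
    elim: l => [|l /(trap_closed trS)[u Su]].
      rewrite addn0; have [w Sw] := SnX _ nX; exact: S'S Sw _.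
    by rewrite addnS; apply: S'S Su _.
  have [|N NP] := @trap_fin _ trS (fun l => rho (l0 + l)).
    by move=> l; rewrite addnS; apply: shiftS.
  exists (l0 + N) => l leNl; rewrite -(subnKC (leq_trans (leq_addr _ _) leNl)).
  by apply: NP; rewrite leq_subRL // (leq_trans (leq_addr _ _) leNl).
exists 0 => l _ Tl; apply: allX; exists l.+1.
have [Zl|nZ] := pselect (Z (rho l)); first by case: (S'Z _ _ Zl (rhoS' l)) => _ /(_ Tl).
have [Sl|[Zl]] := rhoS' l; last by case: nZ.
by have [u Su] := trap_closed trS Sl; move/(_ u).
Qed.

End Determinacy.

(** * Unilateral deviations *)

Section Deviation.
Variables (n : nat) (V : Type) (A : arena n V) (s : profile A) (i : 'I_n).
Variable v0 : V.

Lemma history_rcons (h : seq V) v w :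
  is_history A (rcons h v) -> edge A v w -> is_history A (rcons (rcons h v) w).
Proof.
move=> [rho play [l hE]] vw.
have sz : size h = l by move/(congr1 size): hE; rewrite size_rcons size_mkseq => -[].
have [hl vl] : h = mkseq rho l /\ v = rho l.
  by have [] : (h, v) = (mkseq rho l, rho l) by apply: rcons_inj; rewrite -mkseqSr.
pose rho' k := if k <= l then rho k else w.
have -> : rcons (rcons h v) w = mkseq rho' l.+2.
  rewrite mkseqSr [rho' l.+1]/rho' ltnn hE; congr rcons.
  by apply/eq_in_map => k; rewrite mem_iota /rho' ltnS /= => ->.
apply: path_history => k; rewrite ltnS /rho' {1}leq_eqVlt => /predU1P[->|ltkl].
  by rewrite leqnn ltnn -vl.
by rewrite ltnW // ltkl; apply: play.
Qed.

Lemma deviation_play (rho : nat -> V) : is_play A rho -> rho 0 = v0 ->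
  (forall j, j <> i -> consistent (s j) rho) ->
  exists t : strategy A i, Out (dfwith s t) v0 = rho.
Proof.
move=> play rho0 cons.
(* Off the prefixes of [rho] the strategy falls back on [s i], so that its moves stay legal on all
   histories. *)
pose mv h v := if `[< rcons h v = mkseq rho (size h).+1 >] then rho (size h).+1
               else s i h v.
have mvP h v : is_history A (rcons h v) -> owner A v = i -> edge A v (mv h v).
  rewrite /mv; case: asboolP => [|_]; last exact: moveP.
  by rewrite mkseqSr => /rcons_inj[_ ->] _ _; apply: play.
exists (Strategy mvP); apply/esym/OutP; split => // j.
case: dfwithP => [l _ /=|j' /eqP ne]; last by apply: cons => ?; apply: ne.
by rewrite /mv size_mkseq -mkseqSr asboolT.
Qed.

Lemma Out_deviation (t : strategy A i) :
  [/\ is_play A (Out (dfwith s t) v0), Out (dfwith s t) v0 0 = v0 &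
      forall j, j <> i -> consistent (s j) (Out (dfwith s t) v0)].
Proof.
have [play out0 cons] := (OutP (dfwith s t) v0 _).1 erefl; split => // j ji.
by have := cons j; rewrite dfwith_out //; apply/eqP => ij; apply: ji.
Qed.

(** The graph of histories in which player [i] moves freely against the fixed strategies. Vertices
    would not suffice, as these strategies may depend on the whole past. *)
Definition dev_step (p q : seq V * V) : Prop :=
  [/\ q.1 = rcons p.1 p.2, edge A p.2 q.2 &
      owner A p.2 <> i -> q.2 = s (owner A p.2) p.1 p.2].

End Deviation.

(** * Repeated visits to a target, and why equilibrium outcomes stay trapped *)

Section Recurrence.
Variables (P : Type) (step : P -> P -> Prop) (T R : set P).

Fixpoint recurs k p : Prop :=
  if k is k'.+1 then exists2 q, step p q & recurs k' q
  else T p /\ exists2 q, step p q & R q.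

(** Each state pairs a position with a countdown to the next visit to [T]. At zero the visit takes
    place and the next position lies in [R], which supplies a new countdown. *)
Lemma infinitely_often_path k0 p0 :
  (forall p, R p -> exists k, recurs k p) -> recurs k0 p0 ->
  exists f : nat -> P, [/\ f 0 = p0, forall l, step (f l) (f l.+1) &
    forall N, exists2 l, N <= l & T (f l)].
Proof.
move=> Rrec p0k; pose st := {x : P * nat | recurs x.2 x.1}.
have nextP (x : st) : exists y : st, step (sval x).1 (sval y).1 /\
    if (sval x).2 is k.+1 then (sval y).2 = k else T (sval x).1.
  case: x => -[p [|k]] /=.
    by case=> Tp [q pq /Rrec[k qk]]; exists (exist _ (q, k) qk).
  by case=> q pq qk; exists (exist _ (q, k) qk).
have [nx nxP] := choice nextP.
pose f l := iter l nx (exist _ (p0, k0) p0k : st).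
exists (fun l => (sval (f l)).1); split=> [//|l|N].
  exact: (nxP (f l)).1.
move: {2}(sval (f N)).2 (erefl (sval (f N)).2) => k.
elim: k N => [|k IHk] N fN; have := (nxP (f N)).2; rewrite fN.
  by move=> TN; exists N.
by move=> /(IHk N.+1)[l ltNl Tl]; exists l => //; apply: ltnW.
Qed.

End Recurrence.

(** From a vertex of the outcome outside the domain of [S], player [i] could force visits to [T],
    each followed by a return outside the domain; this is a winning deviation. *)
Lemma Nash_trapped (n : nat) (V : Type) (A : arena n V) (s : profile A)
    (i : 'I_n) (v0 : V) (T : set V) (S : set (V * V)) :
  trap A i T S ->
  (forall v, (forall w, ~ S (v, w)) ->
     attr A i T [set u | forall w, ~ S (u, w)] v) ->
  (~ exists t : strategy A i, Buchi A T (Out (dfwith s t) v0)) ->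
  forall l, exists w, S (Out s v0 l, w).
Proof.
move=> trS attrS nodev l; apply: contrapT => nSl; apply: nodev.
pose X := [set u | forall w, ~ S (u, w)].
have Xl : X (Out s v0 l) by move=> w Sw; apply: nSl; exists w.
pose T' := [set p : seq V * V | T p.2].
pose H := [set p : seq V * V | is_history A (rcons p.1 p.2)].
pose R := H `&` [set p | X p.2].
have Hstep p q : H p -> dev_step s i p q -> H q.
  by case: p q => h v [_ w] Hp [/= -> vw _]; apply: history_rcons.
have ctrl Y p : H p -> controls A i Y p.2 ->
    exists2 q, dev_step s i p q & H q /\ Y q.2.
  move=> Hp [[vi [w vw Yw]]|[vi allY]].
    pose q := (rcons p.1 p.2, w); have pq : dev_step s i p q by split.
    by exists q => //; split => //; apply: Hstep pq.
  pose q := (rcons p.1 p.2, s (owner A p.2) p.1 p.2).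
  have vw : edge A p.2 q.2 by apply: moveP.
  have pq : dev_step s i p q by split.
  by exists q => //; split; [apply: Hstep pq|apply: allY].
(* Against fixed strategies, forcing turns into the existence of a finite path, by induction on the
   attractor. *)
have attrR v : attr A i T X v -> forall h, H (h, v) ->
    exists k, recurs (dev_step s i) T' R k (h, v).
  elim=> {v} [v Tv cX|v w vi vw _ IHw|v vi _ IHv] h Hhv.
  - have [q pq HXq] := ctrl _ (h, v) Hhv cX.
    by exists 0; split => //; exists q.
  - have pq : dev_step s i (h, v) (rcons h v, w) by split.
    by have [k wk] := IHw _ (Hstep _ _ Hhv pq); exists k.+1; exists (rcons h v, w).
  - pose w := s (owner A v) h v.
    have vw : edge A v w by apply: moveP.
    have pq : dev_step s i (h, v) (rcons h v, w) by split.
    have [k wk] := IHv _ vw _ (Hstep _ _ Hhv pq).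
    by exists k.+1; exists (rcons h v, w).
have Hout m : H (mkseq (Out s v0) m, Out s v0 m).
  by rewrite /H /= -mkseqSr; apply: path_history => k _; apply: Out_play.
have [k0 rec0] : exists k, recurs (dev_step s i) T' R k ([::], v0).
  have : exists k, recurs (dev_step s i) T' R k (mkseq (Out s v0) l, Out s v0 l).
    by apply: (attrR _ (attrS _ Xl)); apply: Hout.
  elim: l {nSl Xl} => [//|l IHl] [k kP]; apply: IHl; exists k.+1.
  exists (mkseq (Out s v0) l.+1, Out s v0 l.+1) => //; split=> /=.
  - exact: mkseqSr.
  - exact: Out_play.
  - by rewrite -OutS.
have [p [Hp Xp]|f [f0 fstep fT]] := infinitely_often_path _ rec0.
  by case: p Hp Xp => h v Hp Xp; apply: attrR => //; apply: attrS.
pose rho m := (f m).2.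
have fE m : f m = (mkseq rho m, rho m).
  elim: m => [|m IHm]; first by rewrite /rho f0.
  by rewrite [LHS]surjective_pairing mkseqSr; case: (fstep m) => -> _ _; rewrite {1}IHm.
have play : is_play A rho by move=> m; case: (fstep m).
have [||t tE] := @deviation_play _ _ A s i v0 rho play.
- by rewrite /rho f0.
- by move=> j ji m mj; case: (fstep m) => _ _; rewrite fE mj => /(_ ji).
exists t; rewrite tE; split => //; apply/infinite_set_natP => N.
by have [m ? Tm] := fT N; exists m.
Qed.

(** * The finite-memory profile built from a lasso *)

Section Lasso.
Variables (n : nat) (V : eqType) (A : arena n V) (T : 'I_n -> set V).
Variables (sat : set 'I_n) (v0 : V) (S : 'I_n -> set (V * V)).

(* A lasso cut into K + p segments: the first p form the handle and have one
   vertex each, the others form the loop. *)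
Variables (p' K' : nat) (sg : nat -> seq V).
Local Notation p := p'.+1.
Local Notation K := K'.+1.
Local Notation nx j := (if j.+1 == p + K then p else j.+1).

Hypothesis sg_handle : forall j, j < p -> size (sg j) = 1.
Hypothesis sg_gt0 : forall j, j < p + K -> 0 < size (sg j).
Hypothesis sg_uniq : forall j, j < p + K -> uniq (sg j).
Hypothesis sg_start : head v0 (sg 0) = v0.
(** Past the end of a segment [nth] returns the head of the next one, so a single clause covers
    inner edges and links between segments. *)
Hypothesis sg_walk : forall j t, j < p + K -> t < size (sg j) ->
  edge A (nth v0 (sg j) t) (nth (head v0 (sg (nx j))) (sg j) t.+1).
Hypothesis S_trap : forall i, ~ sat i -> trap A i (T i) (S i).
Hypothesis sg_trapped : forall i j v,
  ~ sat i -> j < p + K -> v \in sg j -> exists w, S i (v, w).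
Hypothesis sg_avoid : forall i j v,
  ~ sat i -> p <= j -> j < p + K -> v \in sg j -> ~ T i v.
Hypothesis sg_visit : forall i, sat i ->
  exists j v, [/\ p <= j, j < p + K, v \in sg j & T i v].

Definition succ (v : V) : V := projT1 (cid (edge_total A v)).

Definition legal (v w : V) : V := if `[< edge A v w >] then w else succ v.

Lemma legalP v w : edge A v (legal v w).
Proof.
by rewrite /legal; case: asboolP => // _; rewrite /succ; case: cid.
Qed.

Definition punish (q : 'I_n) (v : V) : V :=
  if pselect (exists w, S q (v, w)) is left e then projT1 (cid e) else succ v.

Lemma punishP q v w : S q (v, w) -> S q (v, punish q v).
Proof.
move=> Sw; rewrite /punish; case: pselect => [e|[]]; last by exists w.
by case: cid.
Qed.

(* In the loop the memory records the current segment and the owner of the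
   previous vertex, who is to blame if the segment is left; in the handle the
   previous vertex is determined by the segment. After a deviation only the
   player to be punished is kept. *)
Definition memory : finType := ('I_p + 'I_n * 'I_K + 'I_n)%type.

Definition on_lasso (j : nat) (q : 'I_n) : memory :=
  if j < p then inl (inl (inord j)) else inl (inr (q, inord (j - p))).

Definition segment (m : memory) : option nat :=
  match m with
  | inl (inl j) => Some (j : nat)
  | inl (inr (_, j)) => Some (p + j)
  | inr _ => None
  end.

Definition suspect (m : memory) : 'I_n :=
  match m with
  | inl (inl j) => owner A (head v0 (sg j.-1))
  | inl (inr (q, _)) => q
  | inr q => q
  end.

Definition lasso_up (m : memory) (v : V) : memory :=
  if segment m is Some j then
    if v \in sg j then
      on_lasso (if (index v (sg j)).+1 < size (sg j) then j else nx j)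
               (owner A v)
    else inr (suspect m)
  else m.

Definition lasso_nxt (m : memory) (v : V) : V :=
  legal v (if segment m is Some j then
             if v \in sg j then
               nth (head v0 (sg (nx j))) (sg j) (index v (sg j)).+1
             else punish (suspect m) v
           else punish (suspect m) v).

Definition lasso_machine : mealy V :=
  @Mealy V memory (inl (inl ord0)) lasso_up lasso_nxt.

Definition lasso_profile : profile A := fun i =>
  @Strategy n V A i (fun h v => lasso_nxt (up_hat lasso_machine h) v)
    (fun _ _ _ _ => legalP _ _).

Lemma lasso_memory i : memory_at_most (p + n * K + n) (lasso_profile i).
Proof.
exists lasso_machine => //.
by rewrite !card_sum card_prod !card_ord.
Qed.

Lemma segment_on_lasso j q : j < p + K -> segment (on_lasso j q) = Some j.
Proof.
rewrite /on_lasso; case: (ltnP j p) => [ltjp _|lepj ltj] /=; first by rewrite inordK.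
by rewrite inordK ?subnKC // ltn_subLR.
Qed.

(** * Plays observed by the machine *)

Section Play.
Variable rho : nat -> V.
Hypothesis rho0 : rho 0 = v0.

Let mem l := up_hat lasso_machine (mkseq rho l).

Let memS l : mem l.+1 = lasso_up (mem l) (rho l).
Proof. by rewrite /mem mkseqSr /up_hat -cats1 foldl_cat. Qed.

Let follows l := rho l.+1 = lasso_nxt (mem l) (rho l).

Definition on_track l j t :=
  [/\ j < p + K, t < size (sg j), rho l = nth v0 (sg j) t &
      segment (mem l) = Some j].

Lemma nx_lt j : j < p + K -> nx j < p + K.
Proof.
case: eqP => [_ _|/eqP ne ltj]; first by rewrite -[ltnLHS]addn0 ltn_add2l.
by rewrite ltn_neqAle ne.
Qed.

Lemma on_track0 : on_track 0 0 0.
Proof.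
by split => //; [apply: sg_gt0|rewrite nth0 sg_start].
Qed.

Lemma on_track_mem l j t : on_track l j t ->
  segment (mem l.+1) = Some (if t.+1 < size (sg j) then j else nx j) /\
  suspect (mem l.+1) = owner A (rho l).
Proof.
move=> [ltj ltt rhol segl]; have rhoj : rho l \in sg j by rewrite rhol mem_nth.
rewrite memS /lasso_up segl rhoj rhol index_uniq ?sg_uniq //.
rewrite segment_on_lasso; last by case: ifP => // _; apply: nx_lt.
(* If the new state lies in the handle, then so does segment [j], whose only vertex is [rho l]. *)
split=> //; rewrite /on_lasso; case: ifP => [|//].
case: ifP => [lt1 ltjp|_]; first by move: lt1; rewrite sg_handle.
case: eqP => [_|_ ltjp] /=; first by rewrite ltnn.
have sz1 := sg_handle (ltnW ltjp).
by rewrite inordK //= -nth0; move: ltt; rewrite sz1; case: (t).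
Qed.

Lemma on_track_step l j t : on_track l j t -> follows l ->
  if t.+1 < size (sg j) then on_track l.+1 j t.+1 else on_track l.+1 (nx j) 0.
Proof.
move=> tr fol; have [segS _] := on_track_mem tr.
have [ltj ltt rhol segl] := tr; have rhoj : rho l \in sg j by rewrite rhol mem_nth.
have rhoS : rho l.+1 = nth (head v0 (sg (nx j))) (sg j) t.+1.
  rewrite fol /lasso_nxt segl rhoj rhol index_uniq ?sg_uniq // /legal asboolT //.
  exact: sg_walk.
case: ifP segS => [ltS|/negbT leS] segS.
  by split => //; rewrite rhoS; apply: set_nth_default.
have ltnx := nx_lt ltj.
split => //; first exact: sg_gt0.
by rewrite rhoS nth_default ?nth0 // leqNgt.
Qed.

(** * Deviations of a player whose objective fails *)

Section Deviator.
Variable i : 'I_n.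
Hypothesis nsat_i : ~ sat i.
Hypothesis rho_play : is_play A rho.
Hypothesis others_follow : forall l, owner A (rho l) <> i -> follows l.

(** The last clause holds both when the expected segment has just been left and later, when the
    memory names no segment. *)
Definition caught l := [/\ suspect (mem l) = i, exists w, S i (rho l, w) &
  forall j, segment (mem l) = Some j -> rho l \notin sg j].

Lemma caught_step l : caught l -> caught l.+1 /\ S i (rho l, rho l.+1).
Proof.
move=> [susp [w Sw] out].
have Snext : S i (rho l, rho l.+1).
  have [ri|ri] := pselect (owner A (rho l) = i).
    exact: (trap_free (S_trap nsat_i)) ri Sw (rho_play l).
  have Spun : S i (rho l, punish i (rho l)) by apply: punishP Sw.
  have -> // : rho l.+1 = punish i (rho l).
  have epun := trap_edge (S_trap nsat_i) Spun.
  rewrite others_follow // /lasso_nxt susp; move: out.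
  case: segment => [j|_]; last by rewrite /legal asboolT.
  by move=> /(_ j erefl)/negbTE ->; rewrite /legal asboolT.
have [segS suspS] : segment (mem l.+1) = None /\ suspect (mem l.+1) = i.
  rewrite memS /lasso_up; case segl : segment out => [j|] // out.
  by rewrite (negbTE (out j erefl)).
split=> //; split => //; last by rewrite segS.
exact: trap_closed (S_trap nsat_i) _ _ Snext.
Qed.

(** In the handle each step on track advances one segment, whence the bound [minn l p]: from time
    [p] on, the play is in the loop or the deviator is caught. *)
Lemma track_or_caught l :
  (exists j t, on_track l j t /\ minn l p <= j) \/ caught l.
Proof.
elim: l => [|l [[j [t [tr lej]]]|/caught_step[]]]; last by right.
  by left; exists 0, 0; split; [exact: on_track0|rewrite min0n].
have [segS suspS] := on_track_mem tr; have [ltj ltt rhol segl] := tr.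
set j' := if _ then _ else _ in segS.
have lej' : minn l.+1 p <= j'.
  rewrite /j'; case: ifP => [lt1|_].
    rewrite geq_min [X in _ || X]leqNgt; case: (ltnP j p) => [ltjp|_]; last by rewrite orbT.
    by move: lt1; rewrite sg_handle.
  case: eqP => _; first exact: geq_minr.
  apply: (@leq_trans (minn l p).+1); last by rewrite ltnS.
  by rewrite -minnSS leq_min geq_minl geq_min leqnSn orbT.
have rhoj : rho l \in sg j by rewrite rhol mem_nth.
have [ri|ri] := pselect (owner A (rho l) = i); last first.
  left; have := on_track_step tr (others_follow ri).
  by move: lej'; rewrite /j'; case: ifP => _ lej' tr'; do 2!eexists; split; eauto.
have ltj' : j' < p + K by rewrite /j'; case: ifP => // _; apply: nx_lt.
case: (boolP (rho l.+1 \in sg j')) => [inj'|outj'].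
  left; exists j', (index (rho l.+1) (sg j')); split => //.
  by split => //; rewrite ?index_mem ?nth_index.
right; split; first by rewrite suspS.
  have [w Sw] := sg_trapped nsat_i ltj rhoj.
  have Srho := trap_free (S_trap nsat_i) ri Sw (rho_play l).
  exact: trap_closed (S_trap nsat_i) _ _ Srho.
by move=> j1; rewrite segS => -[<-].
Qed.

Lemma deviation_finite : ~ infinite_set [set l | T i (rho l)].
Proof.
move=> /infinite_set_natP infT.
have [[l0 ct]|nct] := pselect (exists l, caught l).
  have ctl l : caught (l0 + l).
    by elim: l => [|l /caught_step[]]; rewrite ?addn0 ?addnS.
  have [|N NP] := @trap_fin _ _ _ _ _ _ (S_trap nsat_i) (fun l => rho (l0 + l)).
    by move=> l; rewrite addnS; case: (caught_step (ctl l)).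
  have [l leNl] := infT (l0 + N).
  rewrite -(subnKC (leq_trans (leq_addr _ _) leNl)); apply: NP.
  by rewrite leq_subRL // (leq_trans (leq_addr _ _) leNl).
have [l lepl Tl] := infT p.
have [[j [t [[ltj ltt rhol _] lej]]]|ct] := track_or_caught l; last by apply: nct; exists l.
apply: (sg_avoid nsat_i _ ltj _ Tl); first by rewrite -(minn_idPr lepl).
by rewrite rhol mem_nth.
Qed.

End Deviator.

(** * The outcome of the lasso profile *)

Section Outcome.
Hypothesis all_follow : forall l, follows l.

Lemma always_on_track l : exists j t, on_track l j t.
Proof.
elim: l => [|l [j [t tr]]]; first by exists 0, 0; exact: on_track0.
have := on_track_step tr (all_follow l).
by case: ifP => _ tr'; do 2!eexists; eauto.
Qed.

Lemma on_track_within l j t t2 : on_track l j t -> t <= t2 -> t2 < size (sg j) ->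
  exists2 l2, l <= l2 & on_track l2 j t2.
Proof.
move=> tr /subnKC <-; elim: (t2 - t) => [|k IHk] ltk; first by exists l; rewrite ?addn0.
move: ltk; rewrite addnS => ltk.
have [l2 lel2 tr2] := IHk (ltnW ltk); exists l2.+1; first exact: leqW.
by have := on_track_step tr2 (all_follow l2); rewrite ltk.
Qed.

Lemma on_track_nx l j t : on_track l j t ->
  exists2 l2, l <= l2 & on_track l2 (nx j) 0.
Proof.
move=> tr; have [ltj ltt _ _] := tr.
have sj : 0 < size (sg j) by apply: sg_gt0.
have [||l2 lel2 tr2] := on_track_within (t2 := (size (sg j)).-1) tr.
- by rewrite -ltnS prednK.
- by rewrite prednK.
exists l2.+1; first exact: leqW.
by have := on_track_step tr2 (all_follow l2); rewrite prednK // ltnn.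
Qed.

Lemma on_track_up l j j2 : on_track l j 0 -> j <= j2 -> j2 < p + K ->
  exists2 l2, l <= l2 & on_track l2 j2 0.
Proof.
move=> tr /subnKC <-; elim: (j2 - j) => [|k IHk] ltk; first by exists l; rewrite ?addn0.
move: ltk; rewrite addnS => ltk; have [l2 lel2 tr2] := IHk (ltnW ltk).
have [l3 lel3 tr3] := on_track_nx tr2; exists l3; first exact: leq_trans lel3.
by move: tr3; rewrite (ltn_eqF ltk).
Qed.

Lemma outcome_infinite i : sat i -> infinite_set [set l | T i (rho l)].
Proof.
move=> sati; apply/infinite_set_natP => N.
have [j2 [v [lepj ltj vj Tv]]] := sg_visit sati.
have [j [t tr]] := always_on_track N; have [ltj1 _ _ _] := tr.
have [l0 le0 tr0] := on_track_nx tr.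
(* Running to the last segment and wrapping around reaches the first loop segment, from which [j2]
   lies ahead. *)
have [||l1 le1 tr1] := on_track_up (j2 := (p + K).-1) tr0.
- by rewrite addnS -ltnS -addnS; apply: nx_lt.
- by rewrite addnS.
have [l2 le2 tr2] := on_track_nx tr1; rewrite addnS eqxx in tr2.
have [l3 le3 tr3] := on_track_up tr2 lepj ltj.
have [||l4 le4 [_ _ rho4 _]] := on_track_within (t2 := index v (sg j2)) tr3 => //.
  by rewrite index_mem.
exists l4; last by rewrite /= rho4 nth_index.
by do 4!(apply: leq_trans; last eassumption).
Qed.

End Outcome.
End Play.
End Lasso.

(** * Lassos extracted from the old outcome *)

Section Existence.
Variables (n : nat) (V : choiceType) (A : arena n V) (T : 'I_n -> set V).
Variables (v0 : V) (s' : profile A).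
Hypothesis s'_Nash : Nash (Buchi_game A T) s' v0.

Local Notation rho := (Out s' v0).
Local Notation sat := (SatPl (Buchi_game A T) rho).
Local Notation nx p K j := (if j.+1 == p + K then p else j.+1).

Lemma unsat_settled :
  exists N, forall i l, ~ sat i -> N <= l -> ~ T i (rho l).
Proof.
have /choice[N NP] i : exists N, ~ sat i -> forall l, N <= l -> ~ T i (rho l).
  have [satN|nsat] := pselect (sat i); first by exists 0.
  apply: contrapT => nN; apply: nsat; split; first exact: Out_play.
  apply/infinite_set_natP => N; apply: contrapT => noT; apply: nN.
  by exists N => _ l leNl Tl; apply: noT; exists l.
exists (\max_i N i) => i l nsat leNl; apply: NP => //.
by apply: leq_trans leNl; apply: leq_bigmax.
Qed.

(** Segments drawn from the old outcome inherit its trapping; drawn from time [N] on in the loop,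
    they also avoid the targets of the unsatisfied players. *)
Lemma equilibrium_of_lasso N p' K' (sg : nat -> seq V) :
  let p := p'.+1 in let K := K'.+1 in
  (forall i l, ~ sat i -> N <= l -> ~ T i (rho l)) ->
  (forall j, j < p -> size (sg j) = 1) ->
  (forall j, j < p + K -> 0 < size (sg j)) ->
  (forall j, j < p + K -> uniq (sg j)) ->
  head v0 (sg 0) = v0 ->
  (forall j t, j < p + K -> t < size (sg j) ->
    edge A (nth v0 (sg j) t) (nth (head v0 (sg (nx p K j))) (sg j) t.+1)) ->
  (forall j v, j < p + K -> v \in sg j ->
    exists2 l, v = rho l & p <= j -> N <= l) ->
  (forall i, sat i ->
    exists j v, [/\ p <= j, j < p + K, v \in sg j & T i v]) ->
  exists s : profile A,
    [/\ forall i, memory_at_most (p + n * K + n) (s i),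
        Nash (Buchi_game A T) s v0 & SatPl (Buchi_game A T) (Out s v0) = sat].
Proof.
move=> p K settled hdl gt0 un start walk onrho visit.
have /choice[S SP] i : exists S : set (V * V), ~ sat i ->
    trap A i (T i) S /\ forall l, exists w, S (rho l, w).
  have [sati|nsat] := pselect (sat i); first by exists set0.
  have [S trS attrS] := maximal_trap A i (T i); exists S => _; split => //.
  by apply: (Nash_trapped trS attrS); apply: s'_Nash.
have S_trap i (nsat : ~ sat i) : trap A i (T i) (S i) by case: (SP i nsat).
have trapped i j v : ~ sat i -> j < p + K -> v \in sg j -> exists w, S i (v, w).
  by move=> nsat ltj /(onrho _ _ ltj)[l -> _]; case: (SP i nsat).
have avoid i j v : ~ sat i -> p <= j -> j < p + K -> v \in sg j -> ~ T i v.
  by move=> nsat lepj ltj /(onrho _ _ ltj)[l -> /(_ lepj)]; apply: settled.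
pose s := lasso_profile A v0 S p' K' sg.
have unsatP i (t : strategy A i) : ~ sat i -> ~ Buchi A (T i) (Out (dfwith s t) v0).
  move=> nsat [play]; have [_ out0 cons] := Out_deviation s v0 t.
  apply: (deviation_finite hdl gt0 un start walk S_trap trapped avoid out0 nsat play).
  by move=> l ne; apply: (cons _ ne l erefl).
have satE : SatPl (Buchi_game A T) (Out s v0) = sat.
  apply/seteqP; split=> i /=.
    (* Keeping [s i] is itself a deviation of [i], so [unsatP] also covers the outcome of [s]. *)
    move=> Bi; apply: contrapT => nsat; apply: (unsatP i (s i) nsat).
    have -> // : dfwith s (s i) = s.
    by apply: functional_extensionality_dep => j; case: dfwithP.
  move=> sati; split; first exact: Out_play.
  apply: (outcome_infinite (S := S) hdl gt0 un start walk visit) sati => //.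
  by move=> l; rewrite OutS.
exists s; split => //; first by move=> i; apply: lasso_memory.
by move=> i; rewrite satE => nsat [t Bt]; apply: (unsatP i t nsat).
Qed.

Lemma finite_memory_equilibrium (v : V) :
  infinite_set [set l | rho l = v] ->
  exists s : profile A,
    [/\ finite_memory_profile s, Nash (Buchi_game A T) s v0 &
        SatPl (Buchi_game A T) (Out s v0) = sat].
Proof.
move=> /infinite_set_natP vinf; have [N NP] := unsat_settled.
(* [N.+1] rather than [N] makes the handle non-empty. *)
have [L0 leL0 rhoL0] := vinf N.+1.
have /choice[m mP] i : exists m, sat i -> L0 <= m /\ T i (rho m).
  have [[_ /infinite_set_natP/(_ L0)[m lem Tm]]|nsat] := pselect (sat i).
    by exists m.
  by exists 0.
(* The loop runs between two occurrences of [v] and is long enough to contain every [m i] with [i]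
   satisfied. *)
have [L1 leL1 rhoL1] := vinf (maxn L0 (\max_i m i)).+1.
have ltL : L0 < L1 by apply: leq_trans leL1; rewrite ltnS leq_maxl.
have pE : L0.-1.+1 = L0 by rewrite prednK // (leq_trans _ leL0).
have KE : (L1 - L0).-1.+1 = L1 - L0 by rewrite prednK ?subn_gt0.
have [||||||||s [mem_s Nash_s sat_s]] := @equilibrium_of_lasso N L0.-1 (L1 - L0).-1
    (fun j => [:: rho j]); rewrite ?pE ?KE ?subnKC ?(ltnW ltL) //.
- move=> j [|t] //= ltj _; case: eqP => [jL1|_]; last exact: Out_play.
  by rewrite rhoL0 -rhoL1 -jL1; apply: Out_play.
- move=> j w ltj; rewrite inE => /eqP ->; exists j => // leL0j.
  exact: leq_trans (ltnW leL0) leL0j.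
- move=> i sati; have [lem Tm] := mP i sati; exists (m i), (rho (m i)).
  split; rewrite ?mem_head // (leq_trans _ leL1) // ltnS.
  by rewrite leq_max orbC leq_bigmax.
exists s; split => // i; have [M _ Ms] := mem_s i; by exists M.
Qed.

(** The end [pi l'] is the default of [nth] instead of a last entry of [s]: it is to be the head of
    the next segment, and may coincide with [pi l]. *)
Lemma shorten_walk (pi : nat -> V) l l' : is_play A pi -> l < l' ->
  exists s : seq V,
    [/\ 0 < size s, uniq s, head v0 s = pi l,
        forall t, t < size s -> edge A (nth v0 s t) (nth (pi l') s t.+1) &
        forall v, v \in s -> exists2 m, v = pi m & l <= m].
Proof.
move=> play ltl; pose e v w := `[< edge A v w >].
have [q [eq lastq inq]] : exists q, [/\ path e (pi l) q, e (last (pi l) q) (pi l') &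
    forall v, v \in pi l :: q -> exists2 m, v = pi m & l <= m].
  rewrite -(subnKC ltl); elim: (l' - l.+1) {ltl} => [|k [q [eq lastq inq]]].
    exists [::]; rewrite addn0; split => //=; first by apply/asboolP; apply: play.
    by move=> v; rewrite inE => /eqP ->; exists l.
  exists (rcons q (pi (l.+1 + k))); split.
  - by rewrite rcons_path eq.
  - by rewrite last_rcons addnS; apply/asboolP; apply: play.
  - move=> v; rewrite -rcons_cons mem_rcons inE => /orP[/eqP ->|/inq//].
    by exists (l.+1 + k) => //; rewrite addSnnS leq_addr.
move: lastq; case/shortenP: eq => q' eq' uq' sub lastq'; exists (pi l :: q').
split => // [t ltt|v].
  have /(pathP v0)/(_ t) : path e (pi l) (rcons q' (pi l')) by rewrite rcons_path eq'.
  rewrite size_rcons => /(_ ltt)/asboolP; rewrite -rcons_cons !nth_rcons /= ltt.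
  move: (nth v0 (_ :: _) t) ltt => v; rewrite /= ltnS leq_eqVlt => /predU1P[->|ltt].
    by rewrite ltnn eqxx nth_default.
  by rewrite ltt (set_nth_default (pi l')).
rewrite inE => /predU1P[->|/sub vq]; last by apply: inq; rewrite inE vq orbT.
by exists l.
Qed.

Lemma bounded_memory_equilibrium k : 0 < n -> ([set: V] #= `I_k)%card ->
  exists s : profile A,
    [/\ forall i, memory_at_most (k + n ^ 2 + n) (s i),
        Nash (Buchi_game A T) s v0 &
        SatPl (Buchi_game A T) (Out s v0) = sat].
Proof.
move=> n_gt0 cardV; have [N NP] := unsat_settled.
have finV : finite_set [set: V] by apply/finite_setP; exists k.
(* Pigeonhole: a property met infinitely often is met infinitely often at one vertex. *)
have recur P : infinite_set [set l | P (rho l)] ->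
    exists2 v, P v & forall M, exists2 l, M <= l & rho l = v.
  move=> infP; apply: contrapT => noP; apply: infP.
  apply: (@sub_finite_set _ _ (\bigcup_(v in setT) [set l | P v /\ rho l = v])).
    by move=> l Pl; exists (rho l).
  apply: bigcup_finite => // v _; have [Pv|nPv] := pselect (P v); last first.
    by apply: (sub_finite_set _ (finite_set0 _)) => l [].
  apply: contrapT => infv; apply: noP; exists v => //.
  by apply/infinite_set_natP; apply: (sub_infinite_set _ infv) => l [].
have [w _ winf] : exists2 v, True & forall M, exists2 l, M <= l & rho l = v.
  by apply: (recur (fun=> True)); apply/infinite_set_natP => M; exists M.
(* For a satisfied player, a target vertex visited infinitely often; for the others, any recurrent
   vertex [w] fills the slot. *)
have /choice[x xP] i : exists x, (sat i -> T i x) /\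
    forall M, exists2 l, M <= l & rho l = x.
  have [[_ /recur[v Tv vinf]]|nsat] := pselect (sat i); first by exists v.
  by exists w.
have nE : n.-1.+1 = n by rewrite prednK.
pose a c := x (cast_ord nE (inord c)).
have ainf c M : exists2 l, M <= l & rho l = a c by case: (xP (cast_ord nE (inord c))).
pose nc c := if c.+1 == n then 0 else c.+1.
(* Segment [c] leads from the vertex chosen for player [c] towards that of the cyclically next
   player. *)
have /choice[sgl sglP] c : exists s : seq V,
    [/\ 0 < size s, uniq s, head v0 s = a c,
        forall t, t < size s -> edge A (nth v0 s t) (nth (a (nc c)) s t.+1) &
        forall v, v \in s -> exists2 m, v = rho m & N <= m].
  have [l leN <-] := ainf c N; have [l' ltl <-] := ainf (nc c) l.+1.
  have [s [sz us hs ws ins]] := shorten_walk (@Out_play _ _ _ s' v0) ltl.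
  by exists s; split => // v /ins[m -> lem]; exists m => //; apply: leq_trans lem.
(* [l0] is positive so that the handle is non-empty even if [v0] is [a 0]. *)
have [l0 l0_gt0 rhol0] := ainf 0 1.
have [u [sz_u uniq_u head_u walk_u in_u]] := shorten_walk (@Out_play _ _ _ s' v0) l0_gt0.
pose sg j := if j < size u then [:: nth v0 u j] else sgl (j - size u).
have uE : (size u).-1.+1 = size u by rewrite prednK.
have sgu j : j < size u -> sg j = [:: nth v0 u j] by rewrite /sg => ->.
have sgE j : size u <= j -> sg j = sgl (j - size u) by rewrite /sg ltnNge => ->.
have [||||||||s [mem_s Nash_s sat_s]] := @equilibrium_of_lasso N (size u).-1 n.-1 sg;
    rewrite ?uE ?nE //.
- by move=> j ltj; rewrite /sg ltj.
- by move=> j _; rewrite /sg; case: ifP => // _; case: (sglP (j - size u)).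
- by move=> j _; rewrite /sg; case: ifP => // _; case: (sglP (j - size u)).
- by rewrite /sg sz_u /= nth0.
- move=> j t ltj; case: (ltnP j (size u)) => [ltju|leuj].
    have -> : (j.+1 == size u + n) = false.
      by apply: ltn_eqF; apply: leq_ltn_trans ltju _; rewrite -[ltnLHS]addn0 ltn_add2l.
    rewrite (sgu j) //; case: t => //= _; have := walk_u _ ltju; rewrite /sg.
    case: ltnP => [ltS|leS]; first by rewrite (set_nth_default v0).
    rewrite (nth_default _ leS) rhol0.
    have /eqP -> : j.+1 - size u == 0 by rewrite subn_eq0.
    by case: (sglP 0) => _ _ ->.
  rewrite !(sgE j) //; have [_ _ _ walk _] := sglP (j - size u).
  move=> /walk; congr (edge A _ (nth _ _ _)).
  have [_ _ <- _ _] := sglP (nc (j - size u)); congr head.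
  rewrite /nc -(eqn_add2l (size u)) addnS subnKC //.
  by case: eqP => _; rewrite sgE ?subnn ?subSn // leqW.
- move=> j v ltj; rewrite /sg; case: ltnP => [ltju|leuj].
    by rewrite inE => /eqP ->; have [m -> _] := in_u _ (mem_nth v0 ltju); exists m.
  by case: (sglP (j - size u)) => _ _ _ _ /[apply] -[m -> leNm]; exists m.
- move=> i sati; exists (size u + i), (x i); split.
  + exact: leq_addr.
  + by rewrite ltn_add2l.
  + rewrite sgE ?leq_addr // addKn; have [sz _ + _ _] := sglP i.
    rewrite /a (_ : cast_ord _ _ = i); last by apply: val_inj; rewrite /= inordK ?nE.
    by case: (sgl i) sz => //= y z _ ->; rewrite mem_head.
  + by case: (xP i) => + _; apply.
exists s; split => // i; have [M leM Ms] := mem_s i; exists M => //.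
apply: (leq_trans leM); rewrite uE nE mulnn !leq_add2r.
rewrite -(card_fset_set cardV); apply: uniq_leq_size => // v _.
by rewrite in_fset_set // in_setT.
Qed.

End Existence.

Theorem theorem42 (n : nat) (n_gt0 : 1 <= n) (V : Type) (A : arena n V)
    (T : 'I_n -> set V) (v0 : V) (s' : profile A)
    (s'_Nash : Nash (Buchi_game A T) s' v0)
    (s'_inf : exists v : V, infinite_set [set l | Out s' v0 l = v]) :
  (exists s : profile A,
     [/\ finite_memory_profile s, Nash (Buchi_game A T) s v0 &
         SatPl (Buchi_game A T) (Out s v0) =
         SatPl (Buchi_game A T) (Out s' v0)]) /\
  (forall k : nat, ([set: V] #= `I_k)%card ->
     exists s : profile A,
       [/\ forall i : 'I_n, memory_at_most (k + n ^ 2 + n) (s i),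
           Nash (Buchi_game A T) s v0 &
           SatPl (Buchi_game A T) (Out s v0) =
         SatPl (Buchi_game A T) (Out s' v0)]).
Proof.
split=> [|k cardV]; last first.
  (* [{classic V}] equips an arbitrary [V] with the decidable equality needed to search segments. *)
  exact: (@bounded_memory_equilibrium n {classic V} A T v0 s' s'_Nash k).
have [v vinf] := s'_inf.
exact: (@finite_memory_equilibrium n {classic V} A T v0 s' s'_Nash v).
Qed.
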